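(* Let $X$ be an $L$-space with a convexifying operator $P$ such that $X^{\rm inv}\cap X^{\rm c}\ne\{\theta\}$, let $(T,r)$ be a metric compact, $Q\subset T$ a compact set, $\mu$ a Borel measure on $T$, $\omega$ a modulus of continuity, and $x_1,\dots,x_n\in T$. Consider $\Lambda f=\int_Q f(s)\,d\mu(s)$ on $W=H^\omega(T,X)$ and the information $I(f)=(P(f(x_1)),\dots,P(f(x_n)))$. Then $$\mathcal E(\Lambda,H^\omega(T,X),I,X)=\int_Q\min_{i=1,\dots,n}\omega(r(x_i,t))\,d\mu(t),$$ and the method $\Phi^*(I(f))=\sum_{i=1}^nP(f(x_i))\,\mu(T_i\cap Q)$ is optimal, where $\tilde T_i=\{t\in T: r(t,x_i)\le r(t,x_j)\ \forall j\ne i\}$, $T_1=\tilde T_1$ and $T_j=\tilde T_j\setminus\bigcup_{i=1}^{j-1}\tilde T_i$ for $j=2,\dots,n$.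
   Context: Semilinear space: a set $X$ with addition and multiplication by reals such that for all $x,y,z\in X$, $\alpha,\beta\in\mathbb R$: $x+y=y+x$; $x+(y+z)=(x+y)+z$; there is $\theta$ with $x+\theta=x$; $\alpha(x+y)=\alpha x+\alpha y$; $\alpha(\beta x)=(\alpha\beta)x$; $1\cdot x=x$, $0\cdot x=\theta$. $x$ is convex if $(\alpha+\beta)x=\alpha x+\beta x$ for all $\alpha,\beta\ge0$ ($X^{\rm c}$: convex elements); $x$ is invertible if $x+x'=\theta$ for some $x'$ ($X^{\rm inv}$: invertible elements). An $L$-space is a semilinear space with a complete separable metric $h_X$ satisfying $h_X(\alpha x,\alpha y)=|\alpha|h_X(x,y)$ and $h_X(x+z,y+z)\le h_X(x,y)$. A convexifying operator is a surjective $P\colon X\to X^{\rm c}$ with $h_X(P(x),P(y))\le h_X(x,y)$, $P\circ P=P$, $P(\alpha x+\beta y)=\alpha P(x)+\beta P(y)$. Integral: $f\colon T\to X$ is measurable if $h_X(f(\cdot),x)$ is Borel measurable for all $x$; for simple bounded $f$ with values $f_i$ on disjoint Borel sets $T_i$ covering $T$, $\int_Tf\,d\mu=\sum_iP(f_i)\mu(T_i)$; for bounded measurable $f$, $\int_Tf\,d\mu$ is the limit of integrals of any uniformly bounded sequence of simple functions converging to $f$ a.e.; $\int_Qf\,d\mu=\int_T\chi_Qf\,d\mu$. Modulus of continuity: non-decreasing continuous $\omega\colon[0,\infty)\to[0,\infty)$, $\omega(0)=0$, $\omega(a+b)\le\omega(a)+\omega(b)$; $H^\omega(T,X)=\{f\colon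 T\to X: h_X(f(s),f(t))\le\omega(r(s,t))\ \forall s,t\}$. Optimal recovery: for a class $W$, a map $\Lambda\colon W\to Z$ into a metric space $(Z,h_Z)$ and an information map $I$ on $W$, a method is any map $\Phi$ from the values of $I$ to $Z$; its error is $\mathcal E(\Lambda,W,I,\Phi,Z)=\sup_{w\in W}h_Z(\Lambda(w),\Phi(I(w)))$; the optimal error is $\mathcal E(\Lambda,W,I,Z)=\inf_\Phi\mathcal E(\Lambda,W,I,\Phi,Z)$, and $\Phi^*$ is optimal if it attains this infimum. *)

(* Defs.v *)
From HB Require Import structures.
From mathcomp Require Import all_boot all_order all_algebra.
From mathcomp Require Import all_classical all_reals all_analysis.
Set Implicit Arguments. Unset Strict Implicit. Unset Printing Implicit Defensive.
Import Order.TTheory GRing.Theory Num.Theory.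
Import numFieldNormedType.Exports.
Local Open Scope classical_set_scope.
Local Open Scope ring_scope.

Record LSpace (R : realType) := {
  lcar :> Type;
  ladd : lcar -> lcar -> lcar;
  lsmul : R -> lcar -> lcar;
  ltheta : lcar;
  ldist : lcar -> lcar -> R;
  laddC : forall x y, ladd x y = ladd y x;
  laddA : forall x y z, ladd x (ladd y z) = ladd (ladd x y) z;
  ladd0 : forall x, ladd x ltheta = x;
  lsmulDr : forall a x y, lsmul a (ladd x y) = ladd (lsmul a x) (lsmul a y);
  lsmulA : forall a b x, lsmul a (lsmul b x) = lsmul (a * b) x;
  lsmul1 : forall x, lsmul 1 x = x;
  lsmul0 : forall x, lsmul 0 x = ltheta;
  ldist_eq0 : forall x y, ldist x y = 0 <-> x = y;
  ldistC : forall x y, ldist x y = ldist y x;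
  ldist_triangle : forall x y z, ldist x z <= ldist x y + ldist y z;
  ldist_complete : forall u : nat -> lcar,
      (forall e : R, 0 < e -> exists N, forall m k, (N <= m)%N -> (N <= k)%N ->
                                   ldist (u m) (u k) < e) ->
      exists l, forall e : R, 0 < e -> exists N, forall m, (N <= m)%N -> ldist (u m) l < e;
  ldist_separable : exists d : nat -> lcar,
      forall x (e : R), 0 < e -> exists k, ldist x (d k) < e;
  ldist_smul : forall a x y, ldist (lsmul a x) (lsmul a y) = `|a| * ldist x y;
  ldist_add : forall x y z, ldist (ladd x z) (ladd y z) <= ldist x y
}.
Arguments ladd {R} l _ _.
Arguments lsmul {R} l _ _.
Arguments ltheta {R} l.
Arguments ldist {R} l _ _.

Section LSpaceDefs.
Variables (R : realType) (X : LSpace R).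

Definition is_convex (x : X) : Prop :=
  forall a b : R, 0 <= a -> 0 <= b ->
    lsmul X (a + b) x = ladd X (lsmul X a x) (lsmul X b x).

Definition is_invertible (x : X) : Prop := exists x' : X, ladd X x x' = ltheta X.

Definition convexifying (P : X -> X) : Prop :=
  [/\ (forall x, is_convex (P x)),
      (forall y, is_convex y -> exists x, P x = y),
      (forall x y, ldist X (P x) (P y) <= ldist X x y),
      (forall x, P (P x) = P x) &
      (forall (a b : R) x y, P (ladd X (lsmul X a x) (lsmul X b y))
                             = ladd X (lsmul X a (P x)) (lsmul X b (P y)))].
End LSpaceDefs.

Definition is_metric (R : realType) (T : Type) (r : T -> T -> R) : Prop :=
  [/\ (forall s t, r s t = 0 <-> s = t),
      (forall s t, r s t = r t s) &
      (forall s t u, r s u <= r s t + r t u)].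

Definition ropen (R : realType) (T : Type) (r : T -> T -> R) (U : set T) : Prop :=
  forall t, U t -> exists2 e : R, 0 < e & forall s, r t s < e -> U s.

Definition rcompact (R : realType) (T : Type) (r : T -> T -> R) (Q : set T) : Prop :=
  forall (I : Type) (U : I -> set T), (forall i, ropen r (U i)) ->
    Q `<=` \bigcup_i U i ->
    exists (m : nat) (g : 'I_m -> I), Q `<=` \bigcup_k U (g k).

Definition borel_for (R : realType) d (T : measurableType d) (r : T -> T -> R) : Prop :=
  (@measurable d T) = <<s [set U | ropen r U] >>.

Definition modulus_of_continuity (R : realType) (w : R -> R) : Prop :=
  [/\ (forall a b, 0 <= a -> a <= b -> w a <= w b),
      {within `[0, +oo[%classic, continuous w},
      (forall a, 0 <= a -> 0 <= w a),
      w 0 = 0 &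
      (forall a b, 0 <= a -> 0 <= b -> w (a + b) <= w a + w b)].

Definition Hclass (R : realType) (T : Type) (r : T -> T -> R) (X : LSpace R)
  (w : R -> R) : set (T -> X) :=
  [set f | forall s t, ldist X (f s) (f t) <= w (r s t)].

Section Integral.
Variables (R : realType) (d : measure_display) (T : measurableType d).
Variables (mu : {measure set T -> \bar R}) (X : LSpace R) (P : X -> X).

Definition Xmeasurable (f : T -> X) : Prop :=
  forall x : X, measurable_fun setT (fun t => ldist X (f t) x).

Definition Xbounded (f : T -> X) : Prop :=
  exists x0 : X, exists C : R, forall t, ldist X (f t) x0 <= C.

Definition simple_integral (f : T -> X) (v : X) : Prop :=
  exists (m : nat) (vals : 'I_m -> X) (A : 'I_m -> set T),
    [/\ (forall i, measurable (A i)),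
        (forall i j, i != j -> A i `&` A j = set0),
        \bigcup_i A i = setT,
        (forall i t, A i t -> f t = vals i) &
        v = \big[ladd X / ltheta X]_(i < m) lsmul X (fine (mu (A i))) (P (vals i))].

Definition is_simple (f : T -> X) : Prop := exists v, simple_integral f v.

Definition Xconverges (u : nat -> X) (l : X) : Prop :=
  (fun k => ldist X (u k) l) @ \oo --> (0 : R).

Definition approx_seq (f : T -> X) (g : nat -> T -> X) : Prop :=
  [/\ (forall k, is_simple (g k)),
      (exists x0 : X, exists C : R, forall k t, ldist X (g k t) x0 <= C) &
      {ae mu, forall t, Xconverges (fun k => g k t) (f t)}].

Definition is_integral (f : T -> X) (v : X) : Prop :=
  [/\ Xmeasurable f, Xbounded f,
      (exists g, approx_seq f g) &
      (forall g (vs : nat -> X), approx_seq f g ->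
          (forall k, simple_integral (g k) (vs k)) -> Xconverges vs v)].

Definition Xintegral (f : T -> X) : X :=
  match pselect (exists v, is_integral f v) with
  | left H => projT1 (cid H)
  | right _ => ltheta X
  end.

Definition Xintegral_on (Q : set T) (f : T -> X) : X :=
  Xintegral (fun t => if pselect (Q t) then f t else ltheta X).
End Integral.

Local Open Scope ereal_scope.
Definition method_error (R : realType) (W : Type) (Z : Type) (I : Type)
  (hZ : Z -> Z -> R) (Lam : W -> Z) (Wc : set W) (Inf : W -> I) (Phi : I -> Z)
  : \bar R :=
  ereal_sup [set (hZ (Lam w) (Phi (Inf w)))%:E | w in Wc].

Definition optimal_error (R : realType) (W : Type) (Z : Type) (I : Type)
  (hZ : Z -> Z -> R) (Lam : W -> Z) (Wc : set W) (Inf : W -> I) : \bar R :=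
  ereal_inf [set method_error hZ Lam Wc Inf Phi | Phi in [set: I -> Z]].
Local Close Scope ereal_scope.

(* Voronoi-type partition: tilde T_i and T_i (0-based indices) *)
Definition tildeT (R : realType) (T : Type) (r : T -> T -> R) (n : nat)
  (x : 'I_n -> T) (i : 'I_n) : set T :=
  [set t | forall j : 'I_n, j != i -> r t (x i) <= r t (x j)].

Definition partT (R : realType) (T : Type) (r : T -> T -> R) (n : nat)
  (x : 'I_n -> T) (j : 'I_n) : set T :=
  tildeT r x j `\` \bigcup_(i in [set i : 'I_n | (i < j)%N]) tildeT r x i.

(* Main.v *)
Require Import Defs.
From HB Require Import structures.
From mathcomp Require Import all_boot all_order all_algebra.
From mathcomp Require Import all_classical all_reals all_analysis.
From mathcomp Require Import measurable_realfun lra.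
Set Implicit Arguments. Unset Strict Implicit. Unset Printing Implicit Defensive.
Import Order.TTheory GRing.Theory Num.Theory.
Import numFieldNormedType.Exports.
Local Open Scope classical_set_scope.
Local Open Scope ring_scope.

(** The integral is a contraction: [h(int f, int g) <= int h(f, g)], first for simple
    functions by passing to a common refinement (convexity of the values of [P] makes
    the sums additive in the sets), then for uniform limits of simple functions.
    Upper bound: [Phi*] is the integral of the step function equal to [f(x_i)] on
    [T_i `&` Q], which is within [m(t) = min_i w(r(x_i, t))] of [f].
    Lower bound: for [z] convex of norm 1 with inverse [z'], the functions [m z] and
    [m z'] belong to the class and carry the same (zero) information, while their
    integrals [c z] and [c z'], [c = int_Q m], satisfy [h(c z, c z') >= h(2c z, theta) = 2c];
    so every method errs by at least [c] on one of them. *)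

(** * Algebra and metric estimates in a semilinear space *)

HB.instance Definition _ (R : realType) (X : LSpace R) :=
  Monoid.isComLaw.Build X (ltheta X) (ladd X)
    (@laddA R X) (@laddC R X) (fun y => etrans (laddC _ _) (ladd0 y)).

Section SemilinearSpace.
Variables (R : realType) (X : LSpace R).

Lemma ldistxx (x : X) : ldist X x x = 0.
Proof. exact/ldist_eq0. Qed.

Lemma ldist_ge0 (x y : X) : 0 <= ldist X x y.
Proof.
have := ldist_triangle x y x; rewrite ldistxx [ldist X y x]ldistC; lra.
Qed.

Lemma lsmul_theta a : lsmul X a (ltheta X) = ltheta X.
Proof. by rewrite -(lsmul0 (ltheta X)) lsmulA mulr0 lsmul0. Qed.

Lemma ldist_lsmul_theta a x :
  ldist X (lsmul X a x) (ltheta X) = `|a| * ldist X x (ltheta X).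
Proof. by have := ldist_smul a x (ltheta X); rewrite lsmul_theta. Qed.

Lemma ldist_addD (x y x' y' : X) :
  ldist X (ladd X x y) (ladd X x' y') <= ldist X x x' + ldist X y y'.
Proof.
apply: le_trans (ldist_triangle _ (ladd X x' y) _) _.
apply: lerD; first exact: ldist_add.
by rewrite (laddC x' y) (laddC x' y'); exact: ldist_add.
Qed.

Lemma ldist_sum (I : Type) (s : seq I) (a b : I -> X) :
  ldist X (\big[ladd X/ltheta X]_(i <- s) a i) (\big[ladd X/ltheta X]_(i <- s) b i)
    <= \sum_(i <- s) ldist X (a i) (b i).
Proof.
elim: s => [|i s IH]; first by rewrite !big_nil ldistxx.
by rewrite !big_cons; apply: le_trans (ldist_addD _ _ _ _) _; rewrite lerD2l.
Qed.

Lemma convex_sum (I : Type) (s : seq I) (a : I -> R) (x : X) :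
  is_convex x -> (forall i, 0 <= a i) ->
  lsmul X (\sum_(i <- s) a i) x = \big[ladd X/ltheta X]_(i <- s) lsmul X (a i) x.
Proof.
move=> cx a0; elim: s => [|i s IH]; first by rewrite !big_nil lsmul0.
by rewrite !big_cons cx ?IH// sumr_ge0.
Qed.

Lemma is_convex_lsmul a (z : X) : 0 <= a -> is_convex z -> is_convex (lsmul X a z).
Proof.
by move=> a0 cz b c b0 c0; rewrite !lsmulA mulrDl cz // mulr_ge0.
Qed.

Section Convexifying.
Variables (P : X -> X) (HP : convexifying P).

Lemma convexifying_id y : is_convex y -> P y = y.
Proof. by case: HP => _ sP _ PP _ /sP[x <-]; rewrite PP. Qed.

Lemma convexifying_theta : P (ltheta X) = ltheta X.
Proof.
case: HP => _ _ _ _ linP.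
by have := linP 0 0 (ltheta X) (ltheta X); rewrite !lsmul0 !ladd0.
Qed.

End Convexifying.

Section Inverse.
Variables (z z' : X) (zz' : ladd X z z' = ltheta X).

Lemma lsmul_inverse a : ladd X (lsmul X a z) (lsmul X a z') = ltheta X.
Proof. by rewrite -lsmulDr zz' lsmul_theta. Qed.

Lemma inverse_unique (x y y' : X) :
  ladd X x y = ltheta X -> ladd X x y' = ltheta X -> y = y'.
Proof.
by move=> e e'; rewrite -(ladd0 y) -e' laddA (laddC y) e laddC ladd0.
Qed.

(** Both sides of the required identity for [z'] are inverses of [(a + b) z], and inverses are
    unique. *)
Lemma inverse_convex : is_convex z -> is_convex z'.
Proof.
move=> cz a b a0 b0; apply: inverse_unique (lsmul_inverse (a + b)) _.
by rewrite cz // Monoid.mulmACA /= !lsmul_inverse ladd0.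
Qed.

(** Translations do not increase distances: adding [z'] sends the pair [z], theta to theta, [z'],
    and adding [z] sends it back. *)
Lemma ldist_inverse_theta : ldist X z' (ltheta X) = ldist X z (ltheta X).
Proof.
apply/le_anti/andP; split.
- have := ldist_add z (ltheta X) z'.
  by rewrite zz' laddC ladd0 ldistC.
- have := ldist_add z' (ltheta X) z.
  by rewrite (laddC z') zz' laddC ladd0 ldistC.
Qed.

(** Adding [c z] to both points does not increase their distance; by convexity it turns them into
    [2c z] and theta. *)
Lemma ldist_lsmul_inverse c : 0 <= c -> is_convex z ->
  2 * c * ldist X z (ltheta X) <= ldist X (lsmul X c z) (lsmul X c z').
Proof.
move=> c0 cz.
have := ldist_add (lsmul X c z) (lsmul X c z') (lsmul X c z).
rewrite -cz // (laddC _ (lsmul X c z)) lsmul_inverse.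
by rewrite ldist_lsmul_theta ger0_norm ?addr_ge0 // mulr_natl mulr2n.
Qed.

End Inverse.

(** For [b <= a] convexity gives [a z = (a - b) z + b z], and dropping the common summand [b z] can
    only increase the distance. *)
Lemma ldist_lsmul_convex (z : X) a b : is_convex z -> 0 <= a -> 0 <= b ->
  ldist X (lsmul X a z) (lsmul X b z) <= `|a - b| * ldist X z (ltheta X).
Proof.
move=> cz.
wlog ba : a b / b <= a => [H a0 b0|a0 b0].
  case: (leP b a) => [ba|/ltW ab]; first exact: H.
  by rewrite ldistC distrC; exact: H.
rewrite -{1}(subrK b a) cz ?subr_ge0 //.
rewrite -{2}(ladd0 (lsmul X b z)) (laddC _ (ltheta X)).
apply: le_trans (ldist_add _ _ _) _.
by rewrite ldist_lsmul_theta.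
Qed.

End SemilinearSpace.

(** * Finite measurable partitions and integrals of simple functions *)

Section SimpleIntegral.
Variables (R : realType) (d : measure_display) (T : measurableType d).
Variables (mu : {measure set T -> \bar R}) (Hmu : (mu setT < +oo)%E).

(** The conditions on the sets in [simple_integral], over any finite index type so that pairs can
    index a common refinement. *)
Definition mpartition {I : finType} (A : I -> set T) : Prop :=
  [/\ (forall i, measurable (A i)),
      (forall i j, i != j -> A i `&` A j = set0) &
      \bigcup_i A i = setT].

Lemma mpartition_inj {I : finType} (A : I -> set T) i j t :
  mpartition A -> A i t -> A j t -> i = j.
Proof.
move=> [_ dA _] Ait Ajt; apply/eqP; apply: contraT => /dA E.
by have : (A i `&` A j) t by []; rewrite E.
Qed.

Lemma mpartition_ex {I : finType} (A : I -> set T) t :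
  mpartition A -> exists i, A i t.
Proof.
by move=> [_ _ cA]; have : setT t by []; rewrite -cA => -[i _ Ait]; exists i.
Qed.

Lemma mpartitionI {I J : finType} (A : I -> set T) (B : J -> set T) :
  mpartition A -> mpartition B -> mpartition (fun p => A p.1 `&` B p.2).
Proof.
move=> pA pB; split=> [[i j]|[i j] [i' j']|] /=.
- by case: pA pB => mA _ _ [mB _ _]; exact: measurableI.
- move=> ne; rewrite -subset0 => t [[At Bt] [At' Bt']].
  move: ne; rewrite (mpartition_inj pA At At') (mpartition_inj pB Bt Bt').
  by rewrite eqxx.
- rewrite -subTset => t _.
  have [i At] := mpartition_ex t pA; have [j Bt] := mpartition_ex t pB.
  by exists (i, j).
Qed.

Lemma measure_fin_num A : measurable A -> mu A \is a fin_num.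
Proof.
move=> mA; rewrite ge0_fin_numE //; apply: le_lt_trans Hmu.
by apply: le_measure; rewrite ?inE.
Qed.

Lemma mpartition_sum m (A : 'I_m -> set T) D : mpartition A -> measurable D ->
  fine (mu D) = \sum_i fine (mu (D `&` A i)).
Proof.
move=> pA mD; have [mA _ cA] := pA.
have mDA i : measurable (D `&` A i) by exact: measurableI.
have E : D = \big[setU/set0]_(i < m) (D `&` A i).
  rewrite -bigcup_seq -setI_bigcupr (_ : \bigcup_(i in _) A i = setT) ?setIT //.
  by rewrite -cA; apply: eq_bigcupl; split=> // i _; rewrite /= mem_index_enum.
rewrite {1}E measure_semi_additive_ord//.
- by rewrite -[RHS]/(fine (_)%:E) EFin_sum_fine// => i _; exact: measure_fin_num.
- apply/trivIsetP => i j _ _ ij; rewrite -subset0 => t [[_ At] [_ At']].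
  by move: ij; rewrite (mpartition_inj pA At At') eqxx.
- exact: bigsetU_measurable.
Qed.

Lemma mpartition_indic {I : finType} (A : I -> set T) (a : I -> R) i t :
  mpartition A -> A i t -> \sum_j a j * \1_(A j) t = a i.
Proof.
move=> pA Ait; rewrite (bigD1 i) //= big1 ?addr0 => [|j ji].
  by rewrite indicE mem_set // mulr1.
rewrite indicE memNset ?mulr0 // => Ajt.
by move: ji; rewrite (mpartition_inj pA Ajt Ait) eqxx.
Qed.

Lemma measurable_sum_indic {I : finType} (A : I -> set T) (a : I -> R) :
  (forall i, measurable (A i)) ->
  measurable_fun setT (fun t => \sum_i a i * \1_(A i) t).
Proof.
by move=> mA; apply: measurable_sum => i; apply: measurable_funM.
Qed.

Lemma integral_sum_indic {I : finType} (A : I -> set T) (a : I -> R) D :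
  measurable D -> (forall i, measurable (A i)) -> (forall i, 0 <= a i) ->
  (\int[mu]_(t in D) (\sum_i a i * \1_(A i) t)%:E
    = (\sum_i a i * fine (mu (A i `&` D)))%:E)%E.
Proof.
move=> mD mA a0.
under eq_integral do rewrite -sumEFin.
rewrite ge0_integral_sum //; last 2 first.
- move=> i; apply/measurable_EFinP; apply: measurable_funM.
    exact: measurable_cst.
  exact: measurable_indic.
- by move=> i t _; rewrite lee_fin mulr_ge0.
rewrite -sumEFin; apply: eq_bigr => i _.
under eq_integral do rewrite EFinM.
rewrite ge0_integralZl_EFin //; last first.
  by apply/measurable_EFinP; exact: measurable_indic.
by rewrite integral_indic // EFinM fineK // measure_fin_num //; exact: measurableI.
Qed.

Variables (X : LSpace R) (P : X -> X) (HP : convexifying P).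

(** Both claims rest on one formula: the pointwise distance of [f] and [g] is a step function on the
    intersections of the cells of the two partitions. *)
Lemma simple_integral_dist (f g : T -> X) (u v : X) :
  simple_integral mu P f u -> simple_integral mu P g v ->
  measurable_fun setT (fun t => ldist X (f t) (g t)) /\
  ((ldist X u v)%:E <= \int[mu]_t (ldist X (f t) (g t))%:E)%E.
Proof.
move=> [m [a [A [mA dA cA fA ->]]]] [k [b [B [mB dB cB gB ->]]]].
have pA : mpartition A by [].
have pB : mpartition B by [].
have pC := mpartitionI pA pB; have mC := let: And3 mC _ _ := pC in mC.
have fgE t : ldist X (f t) (g t) =
    \sum_(p : 'I_m * 'I_k) ldist X (a p.1) (b p.2) * \1_(A p.1 `&` B p.2) t.
  have [i At] := mpartition_ex t pA; have [j Bt] := mpartition_ex t pB.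
  rewrite (@mpartition_indic _ (fun p => A p.1 `&` B p.2) (fun p => ldist X (a p.1) (b p.2)) (i, j)) //=.
  by rewrite (fA i) // (gB j).
under [X in measurable_fun _ X]eq_fun do rewrite fgE.
under eq_integral do rewrite fgE.
split; first exact: measurable_sum_indic.
rewrite integral_sum_indic //; last by move=> p; exact: ldist_ge0.
have [cvxP _ P1 _ _] := HP.
rewrite lee_fin.
(* Each coefficient is split into the masses of the refined cells. Both integrals become sums over
   the same pairs and are compared term by term, [P] being nonexpansive. *)
under eq_bigr => i _ do rewrite (mpartition_sum pB (mA i)) convex_sum //.
rewrite pair_bigA /=.
under [X in ldist _ _ X]eq_bigr => j _ do
  rewrite (mpartition_sum pA (mB j)) convex_sum //.
rewrite exchange_big pair_bigA /=.
apply: le_trans (ldist_sum _ _ _) _.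
apply: ler_sum => -[i j] _ /=; rewrite setIT setIC ldist_smul ger0_norm //.
by rewrite mulrC ler_wpM2r.
Qed.

Lemma simple_integral_dist_le (f g : T -> X) (u v : X) C :
  simple_integral mu P f u -> simple_integral mu P g v ->
  (forall t, ldist X (f t) (g t) <= C) -> ldist X u v <= C * fine (mu setT).
Proof.
move=> fu gv fgC; have [mfg le_uv] := simple_integral_dist fu gv.
rewrite -lee_fin EFinM fineK ?measure_fin_num // -integral_cst //.
apply: le_trans le_uv _; apply: ge0_le_integral => //.
- by move=> t _; rewrite lee_fin ldist_ge0.
- exact/measurable_EFinP.
- by move=> t _; rewrite lee_fin.
Qed.

End SimpleIntegral.

(** * Integrals of uniform limits of simple functions *)

Lemma harmonic_le (R : realType) (e : R) : 0 < e -> 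
  exists N, forall k, (N <= k)%N -> k.+1%:R^-1 <= e.
Proof.
move=> e0; have /cvgr0Pnorm_le/(_ _ e0)[N _ HN] := @cvg_harmonic R.
by exists N => k /HN /=; rewrite ger0_norm.
Qed.

(** Here [M] is the total mass. The denominator has [M + 1] so that a null measure causes no
    division by zero. *)
Lemma div_succ_mul_le (R : realFieldType) (a b M : R) :
  0 <= a -> 0 <= b -> 0 <= M -> a / (b * (M + 1)) * M <= a / b.
Proof.
move=> a0 b0 M0; have M1 : 0 < M + 1 by rewrite ltr_wpDl.
rewrite invfM mulrA -[leRHS]mulr1 -mulrA ler_wpM2l ?divr_ge0 //.
by rewrite mulrC ler_pdivrMr // mul1r; lra.
Qed.

Section Integral.
Variables (R : realType) (d : measure_display) (T : measurableType d).
Variables (mu : {measure set T -> \bar R}) (Hmu : (mu setT < +oo)%E).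
Variables (X : LSpace R) (P : X -> X) (HP : convexifying P).

Lemma XconvergesP (u : nat -> X) l :
  Xconverges u l <->
  forall e : R, 0 < e -> exists N, forall k, (N <= k)%N -> ldist X (u k) l <= e.
Proof.
split=> [/cvgr0Pnorm_le ul e /ul [N _ uN]|ul].
  by exists N => k /uN /=; rewrite ger0_norm // ldist_ge0.
apply/cvgr0Pnorm_le => e /ul [N uN]; exists N => // k /uN /=.
by rewrite ger0_norm // ldist_ge0.
Qed.

(** Dominated convergence for the pointwise distances of [g k] and [g' k]: they tend to 0 almost
    everywhere under a constant bound, integrable as [mu] is finite. Hence the limit of the
    integrals does not depend on the approximating sequence. *)
Lemma approx_seq_dist (f : T -> X) g g' (vs vs' : nat -> X) :
  approx_seq mu P f g -> approx_seq mu P f g' ->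
  (forall k, simple_integral mu P (g k) (vs k)) ->
  (forall k, simple_integral mu P (g' k) (vs' k)) ->
  (fun k => ldist X (vs k) (vs' k)) @ \oo --> (0 : R).
Proof.
move=> [_ [x0 [C gC]] gf] [_ [x0' [C' gC']] gf'] gvs gvs'.
pose h k t := ldist X (g k t) (g' k t).
have mh k : measurable_fun setT (h k).
  by have [] := simple_integral_dist Hmu HP (gvs k) (gvs' k).
have hC k t : h k t <= C + ldist X x0 x0' + C'.
  have := gC k t; have := gC' k t.
  have := ldist_triangle (g k t) x0 (g' k t).
  have := ldist_triangle x0 x0' (g' k t).
  rewrite [ldist X x0' _]ldistC /h; lra.
have h0 : {ae mu, forall t, setT t -> (h k t)%:E @[k --> \oo] --> (cst 0%E : T -> \bar R) t}.
  apply: filterS2 gf gf' => t gt gt' _.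
  apply/fine_cvgP; split; first by apply: nearW.
  have H : (fun k => ldist X (g k t) (f t) + ldist X (g' k t) (f t)) @ \oo --> (0 : R).
    by rewrite -(addr0 (0 : R)); exact: cvgD.
  apply: (squeeze_cvgr _ (cvg_cst 0) H); apply: nearW => k /=.
  by rewrite ldist_ge0 /= /h [ldist X (g' k t) (f t)]ldistC ldist_triangle.
have int : mu.-integrable setT (cst (C + ldist X x0 x0' + C')%:E).
  apply/integrableP; split=> //.
  rewrite /= integral_cst //; apply: lte_mul_pinfty => //.
have bnd : {ae mu, forall t, forall k, setT t ->
    (`|(h k t)%:E| <= cst (C + ldist X x0 x0' + C')%:E t)%E}.
  by apply: aeW => t k _; rewrite /= lee_fin ger0_norm // ldist_ge0.
have [_ _] := @dominated_convergence _ _ _ mu setT measurableT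
  (fun k t => (h k t)%:E) (cst 0%E)
  (cst (C + ldist X x0 x0' + C')%:E)
  (fun k => (measurable_EFinP _ _).2 (mh k)) (measurable_cst _) h0 int bnd.
rewrite integral0 => /fine_cvgP[fin cvh].
apply: (squeeze_cvgr _ (cvg_cst 0) cvh).
case: fin => N _ finN; exists N => // k /finN /= fink.
rewrite ldist_ge0 /= -lee_fin fineK //.
by have [] := simple_integral_dist Hmu HP (gvs k) (gvs' k).
Qed.

(** Uniform approximation, stronger than the almost everywhere limits in [approx_seq], gives
    explicit error bounds for integrals. *)
Definition unif_simple (F : T -> X) : Prop :=
  forall e : R, 0 < e -> exists g u,
    simple_integral mu P g u /\ forall t, ldist X (g t) (F t) <= e.

Section UniformlySimple.
Variables (F : T -> X) (mF : Xmeasurable F) (uF : unif_simple F).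

Lemma unif_simple_bounded : Xbounded F.
Proof.
have [g [u [[m [a [A [_ _ cA gA _]]]] gF]]] := uF ltr01.
(* The 1 is the approximation error; the sum dominates the norm of each of the finitely many
   values. *)
exists (ltheta X), (1 + \sum_i ldist X (a i) (ltheta X)) => t.
have : setT t by [].
rewrite -cA => -[i _ /gA gt].
have := ldist_triangle (F t) (g t) (ltheta X); have := gF t.
rewrite gt [ldist X (F t) (a i)]ldistC.
suff : ldist X (a i) (ltheta X) <= \sum_i ldist X (a i) (ltheta X) by lra.
by rewrite (bigD1 i) //= lerDl sumr_ge0 // => j _; exact: ldist_ge0.
Qed.

Lemma unif_simple_seq : exists g us, approx_seq mu P F g /\
  forall k, simple_integral mu P (g k) (us k) /\
            forall t, ldist X (g k t) (F t) <= k.+1%:R^-1.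
Proof.
have /choice[gu guP] k : exists gu : (T -> X) * X,
    simple_integral mu P gu.1 gu.2 /\
    forall t, ldist X (gu.1 t) (F t) <= k.+1%:R^-1.
  have [|g [u gu]] := uF (e := k.+1%:R^-1); first by rewrite invr_gt0.
  by exists (g, u).
exists (fun k => (gu k).1), (fun k => (gu k).2); split=> //; split.
- by move=> k; exists (gu k).2; case: (guP k).
- have [x0 [C FC]] := unif_simple_bounded; exists x0, (1 + C) => k t.
  apply: le_trans (ldist_triangle _ (F t) _) _; apply: lerD => //.
  apply: le_trans (_ : k.+1%:R^-1 <= 1); first by case: (guP k).
  by rewrite invf_le1 // ler1n.
- apply: aeW => t; apply: (squeeze_cvgr _ (cvg_cst 0) (@cvg_harmonic R)).
  by apply: nearW => k; rewrite ldist_ge0 /=; case: (guP k).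
Qed.

(** The integrals of uniform approximations form a Cauchy sequence, which converges by completeness;
    any other approximating sequence has the same limit by [approx_seq_dist]. *)
Lemma unif_simple_integral_ex : exists v, is_integral mu P F v.
Proof.
have [g [us [gF usP]]] := unif_simple_seq.
set M := fine (mu setT).
have M0 : 0 <= M by exact: fine_ge0.
have dus j k : ldist X (us j) (us k) <= (j.+1%:R^-1 + k.+1%:R^-1) * M.
  have [sj gj] := usP j; have [sk gk] := usP k.
  apply: (simple_integral_dist_le Hmu HP sj sk) => t.
  apply: le_trans (ldist_triangle _ (F t) _) _.
  by rewrite [ldist X (F t) _]ldistC lerD.
have [e e0|l ul] := @ldist_complete R X us.
  (* Two errors of this size, multiplied by the mass, add up to at most [e / 2], which leaves room
     for a strict inequality. *)
  have [|N HN] := @harmonic_le R (e / (4 * (M + 1))).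
    by rewrite divr_gt0 // mulr_gt0 //; lra.
  exists N => j k /HN hj /HN hk; apply: le_lt_trans (dus _ _) _.
  have M1 : 0 < M + 1 by lra.
  have : (j.+1%:R^-1 + k.+1%:R^-1) * M <= (e / (4 * (M + 1)) + e / (4 * (M + 1))) * (M + 1).
    by apply: ler_pM; rewrite ?addr_ge0 ?lerD //; lra.
  move/le_lt_trans; apply.
  rewrite -mulrDl invfM mulrA divfK ?gt_eqF //; lra.
exists l; split => //; first exact: unif_simple_bounded.
  by exists g.
move=> g' vs g'F g'vs.
have H := approx_seq_dist g'F gF g'vs (fun k => (usP k).1).
have us_l : (fun k => ldist X (us k) l) @ \oo --> (0 : R).
  by apply/XconvergesP => e /ul[N HN]; exists N => k /HN /ltW.
have HH : (fun k => ldist X (vs k) (us k) + ldist X (us k) l) @ \oo --> (0 : R).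
  by rewrite -(addr0 (0 : R)); exact: cvgD.
apply: (squeeze_cvgr _ (cvg_cst 0) HH); apply: nearW => k /=.
by rewrite ldist_ge0 ldist_triangle.
Qed.

Lemma Xintegral_dist_le g u e : simple_integral mu P g u ->
  (forall t, ldist X (g t) (F t) <= e) ->
  ldist X (Xintegral mu P F) u <= e * fine (mu setT).
Proof.
move=> gu gF; rewrite /Xintegral; case: pselect => [exv|]; last first.
  by have := unif_simple_integral_ex.
case: cid => v /= [_ _ _ intF].
have [gs [us [gsF usP]]] := unif_simple_seq.
have /XconvergesP usv := intF _ _ gsF (fun k => (usP k).1).
set M := fine (mu setT).
have M0 : 0 <= M by exact: fine_ge0.
apply/ler_addgt0Pr => /= eta eta0; rewrite -/M.
have M1 : 0 < M + 1 by rewrite ltr_wpDl.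
have eta2 : 0 < eta / (2 * (M + 1)) by rewrite divr_gt0 // mulr_gt0.
(* One half of [eta] pays for the convergence of [us] to the integral, the other for the uniform
   error of [gs k] times the mass. *)
have [N1 HN1] := usv _ (divr_gt0 eta0 (ltr0n _ 2)).
have [N2 HN2] := harmonic_le eta2.
pose k := maxn N1 N2.
have {}HN1 := HN1 k (leq_maxl _ _); have {}HN2 := HN2 k (leq_maxr _ _).
have [sk gk] := usP k.
have : ldist X (us k) u <= (eta / (2 * (M + 1)) + e) * M.
  apply: (simple_integral_dist_le Hmu HP sk gu) => t.
  apply: le_trans (ldist_triangle _ (F t) _) _.
  rewrite [ldist X (F t) _]ldistC lerD //; exact: le_trans HN2.
have : eta / (2 * (M + 1)) * M <= eta / 2 by apply: div_succ_mul_le => //; exact: ltW.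
have := ldist_triangle v (us k) u; rewrite [ldist X v (us k)]ldistC mulrDl; lra.
Qed.

(** Replacing [F] by a uniformly close simple [g'] reduces the bound to [simple_integral_dist], with
    [phi] plus a small constant dominating the distance of [g'] and [g]. *)
Lemma Xintegral_dist_integral g u (phi : T -> R) : simple_integral mu P g u ->
  measurable_fun setT phi -> (forall t, ldist X (F t) (g t) <= phi t) ->
  ((ldist X (Xintegral mu P F) u)%:E <= \int[mu]_t (phi t)%:E)%E.
Proof.
move=> gu mphi gF; set M := fine (mu setT).
have M0 : 0 <= M by exact: fine_ge0.
have M1 : 0 < M + 1 by rewrite ltr_wpDl.
have phi0 t : 0 <= phi t by exact: le_trans (ldist_ge0 _ _) (gF t).
apply/lee_addgt0Pr => e e0.
have eM0 : 0 < e / (2 * (M + 1)) by rewrite divr_gt0 // mulr_gt0.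
have [g' [u' [gu' gF']]] := uF eM0.
have [mgg le_gg] := simple_integral_dist Hmu HP gu' gu.
have {}le_gg : ((ldist X u' u)%:E <=
    \int[mu]_t (phi t)%:E + (e / (2 * (M + 1)) * M)%:E)%E.
  apply: le_trans le_gg _.
  rewrite EFinM fineK ?(measure_fin_num Hmu) // -integral_cst // -ge0_integralD //.
  - apply: ge0_le_integral => //.
    + by move=> t _; rewrite lee_fin ldist_ge0.
    + exact/measurable_EFinP.
    + by apply/measurable_EFinP; exact: measurable_funD.
    + move=> t _; rewrite /= -EFinD lee_fin addrC.
      by apply: le_trans (ldist_triangle _ (F t) _) _; exact: lerD.
  - by move=> t _; rewrite lee_fin.
  - exact/measurable_EFinP.
  - by move=> t _; rewrite lee_fin ltW.
have dF := Xintegral_dist_le gu' gF'.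
have eM : e / (2 * (M + 1)) * M <= e / 2 by apply: div_succ_mul_le => //; exact: ltW.
apply: (@le_trans _ _ ((e / 2)%:E + (ldist X u' u)%:E)%E).
  rewrite -EFinD lee_fin; apply: le_trans (ldist_triangle _ u' _) _.
  by rewrite lerD2r; exact: le_trans eM.
apply: le_trans (leeD2l _ le_gg) _.
rewrite addeCA leeD2l // -EFinD lee_fin; lra.
Qed.

End UniformlySimple.
End Integral.

(** * Measurability and partitions in a compact metric space *)

Lemma mpartition_first d (T : measurableType d) m (B : 'I_m -> set T) :
  (forall i, measurable (B i)) -> \bigcup_i B i = setT ->
  mpartition (fun j => B j `\` \bigcup_(i in [set i : 'I_m | (i < j)%N]) B i).
Proof.
move=> mB cB; split=> [j|i j ij|].
- apply: measurableD => //; apply: fin_bigcup_measurable => //.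
- wlog lij : i j ij / (i < j)%N => [H|].
    have : (i : nat) != j by [].
    rewrite neq_ltn => /orP[|] lij; first exact: H.
    by rewrite setIC; apply: H; rewrite // eq_sym.
  rewrite -subset0 => t [[Bit _] [_]]; apply.
  by exists i.
- rewrite -subTset => t _.
  have [i0 _ Bt0] : (\bigcup_i B i) t by rewrite cB.
  (* The point goes to the least index whose set contains it. *)
  case: (@arg_minnP _ i0 (fun i => `[< B i t >]) (@nat_of_ord m)); first exact/asboolP.
  move=> i /asboolP Bit imin; exists i => //; split=> // -[k /= ki Bkt].
  by have := imin k; rewrite leqNgt ki => /(_ (asboolT Bkt)).
Qed.

Section MetricCompact.
Variables (R : realType) (d : measure_display) (T : measurableType d).
Variables (r : T -> T -> R) (Hr : is_metric r) (Hborel : borel_for r).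

Lemma metricxx t : r t t = 0.
Proof. by case: Hr => r0 _ _; exact/r0. Qed.

Lemma metricC s t : r s t = r t s.
Proof. by case: Hr. Qed.

Lemma metric_triangle s t u : r s u <= r s t + r t u.
Proof. by case: Hr. Qed.

Lemma metric_ge0 s t : 0 <= r s t.
Proof.
have := metric_triangle s t s; rewrite metricxx [r t s]metricC; lra.
Qed.

Lemma ropen_measurable U : ropen r U -> measurable U.
Proof. by move=> oU; rewrite Hborel; exact: sub_sigma_algebra. Qed.

Lemma rcontinuous_measurable (g : T -> R) :
  (forall t e, 0 < e -> exists2 dl, 0 < dl & forall s, r t s < dl -> `|g t - g s| <= e) ->
  measurable_fun setT g.
Proof.
move=> cg; apply: (measurability _ (RGenOInfty.measurableE R)) => // _ [_ [a ->] <-].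
rewrite setTI; apply: ropen_measurable => t /=; rewrite in_itv /= andbT => agt.
(* Preimages of open rays are shown to be open; half of the gap keeps the values strictly above
   [a]. *)
have [|dl dl0 H] := cg t ((g t - a) / 2); first by lra.
exists dl => // s /H; rewrite in_itv /= andbT ler_norml => /andP[]; lra.
Qed.

(** Compact sets are closed: for [t] outside [Q], the exteriors of closed balls around [t] cover
    [Q], and a finite subcover leaves a ball around [t] free of [Q]. *)
Lemma rcompact_measurable Q : rcompact r Q -> measurable Q.
Proof.
move=> HQ; rewrite -(setCK Q); apply: measurableC; apply: ropen_measurable => t nQt.
have [e s /= [e0 es]||m [g Qg]] := HQ R (fun e => [set s | 0 < e /\ e < r t s]).
- exists (r t s - e) => [|u su /=]; first by rewrite subr_gt0.
  split=> //; have := metric_triangle t u s; rewrite [r u s]metricC; lra.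
- move=> s Qs; exists (r t s / 2) => //=.
  suff : 0 < r t s by lra.
  rewrite lt_neqAle metric_ge0 andbT eq_sym; apply/eqP.
  by case: Hr => r0 _ _ /r0 ts; apply: nQt; rewrite ts.
(* Nonpositive radii index empty sets and are skipped; the default 1 keeps the minimum positive if
   no radius remains. *)
exists (\big[Order.min/1]_(k | 0 < g k) g k).
  by apply: lt_bigmin.
move=> s ts Qs; have [k _ /= [gk0 gks]] := Qg _ Qs.
have := lt_trans gks ts.
by rewrite ltNge bigmin_le_cond.
Qed.

(** A finite cover by balls is made disjoint. A centre [p i] may fall outside its own cell [A i]. *)
Lemma rcompact_partition (dl : R) : rcompact r setT -> 0 < dl ->
  exists m (A : 'I_m -> set T) (p : 'I_m -> T),
    mpartition A /\ forall i t, A i t -> r (p i) t < dl.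
Proof.
move=> HT dl0; pose U t := [set s | r t s < dl].
have oU t : ropen r (U t).
  move=> s /= ts; exists (dl - r t s) => [|u su /=]; first by rewrite subr_gt0.
  have := metric_triangle t s u; rewrite /U /=; lra.
have [|m [p Up]] := HT T U oU.
  by move=> t _; exists t => //=; rewrite /U /= metricxx.
exists m, (fun j => U (p j) `\` \bigcup_(i in [set i : 'I_m | (i < j)%N]) U (p i)), p.
split; last by move=> i t [].
apply: (@mpartition_first _ _ _ (U \o p)) => [i|].
  by apply: ropen_measurable; exact: oU.
by rewrite -subTset.
Qed.

Section Voronoi.
Variables (n : nat) (hn : (0 < n)%N) (x : 'I_n -> T).

Lemma tildeT_measurable i : measurable (tildeT r x i).
Proof.
rewrite -(setCK (tildeT _ _ _)); apply: measurableC.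
apply: ropen_measurable => t; rewrite /tildeT /= => /existsNP[j /not_implyP[ji]].
move=> /negP; rewrite -ltNge => lt_ji.
(* A move by less than half of the gap changes each distance by less than that, so [x j] stays
   strictly closer than [x i]. *)
exists ((r t (x i) - r t (x j)) / 2) => [|s ts]; first by lra.
move=> /(_ j ji).
have := metric_triangle s t (x j); have := metric_triangle t s (x i).
rewrite [r s t]metricC; lra.
Qed.

Lemma partT_mpartition : mpartition (partT r x).
Proof.
apply: mpartition_first; first exact: tildeT_measurable.
rewrite -subTset => t _.
case: (@arg_minP _ _ _ (Ordinal hn) xpredT (fun i => r t (x i))) => // i _ imin.
by exists i => // j _; exact: imin.
Qed.

End Voronoi.
End MetricCompact.

(** * Moduli of continuity near zero and step functions supported on [Q] *)

Lemma modulus_small (R : realType) (w : R -> R) (e : R) :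
  modulus_of_continuity w -> 0 < e ->
  exists2 dl, 0 < dl & forall a, 0 <= a -> a < dl -> w a <= e.
Proof.
move=> [incr cw w0 w00 _] e0.
have [_] := (continuous_within_itvcyP _ _).1 cw.
rewrite w00 => /cvgr0Pnorm_le/(_ _ e0) we.
(* One positive point with a small value is enough, as [w] is monotone. *)
have : \forall a \near (0 : R)^'+, 0 < a /\ `|w a| <= e.
  apply: filterI we; exact: nbhs_right_gt.
move=> /filter_ex[dl [dl0 wdl]]; exists dl => // a a0 /ltW adl.
apply: le_trans (incr _ _ a0 adl) _.
exact: le_trans (ler_norm _) wdl.
Qed.

Lemma simple_integral_on (R : realType) d (T : measurableType d)
  (mu : {measure set T -> \bar R}) (X : LSpace R) (P : X -> X) (HP : convexifying P)
  (Q : set T) m (A : 'I_m -> set T) (v : 'I_m -> X) (g : T -> X) :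
  measurable Q -> mpartition A ->
  (forall i t, A i t -> Q t -> g t = v i) -> (forall t, ~ Q t -> g t = ltheta X) ->
  simple_integral mu P g
    (\big[ladd X/ltheta X]_(i < m) lsmul X (fine (mu (A i `&` Q))) (P (v i))).
Proof.
move=> mQ pA gA gN; have [mA dA cA] := pA.
(* Index 0 is the complement of [Q] with value theta, which [P] fixes, so its term vanishes; index
   [i + 1] is the part of [A i] in [Q]. *)
pose B (i : 'I_m.+1) := oapp (fun j => A j `&` Q) (~` Q) (unlift ord0 i).
exists m.+1, (fun i => oapp v (ltheta X) (unlift ord0 i)), B; split.
- move=> i; rewrite /B; case: unlift => /= [j|]; last exact: measurableC.
  exact: measurableI.
- move=> i j; rewrite /B.
  case: (unliftP ord0 i) => [i' ->|->]; case: (unliftP ord0 j) => [j' ->|->] /=.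
  + rewrite (inj_eq lift_inj) => /dA ij.
    by rewrite setIACA ij set0I.
  + by move=> _; rewrite -setIA setICr setI0.
  + by move=> _; rewrite [A j' `&` Q]setIC setIA setICl set0I.
  + by [].
- rewrite -subTset => t _.
  have [Qt|nQt] := pselect (Q t); last first.
    by exists ord0 => //; rewrite /B unlift_none.
  have [i At] := mpartition_ex t pA; exists (lift ord0 i) => //.
  by rewrite /B liftK.
- move=> i t; rewrite /B; case: unlift => /= [j [At Qt]|]; first exact: gA.
  exact: gN.
rewrite big_ord_recl /B unlift_none /= (convexifying_theta HP) lsmul_theta.
rewrite laddC ladd0; apply: eq_bigr => i _.
by rewrite !liftK.
Qed.

(** * Step function approximation of class functions *)

Section OptimalRecovery.
Variables (R : realType) (X : LSpace R) (P : X -> X) (HP : convexifying P).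
Variables (d : measure_display) (T : measurableType d) (r : T -> T -> R).
Variables (Hr : is_metric r) (HT : rcompact r setT) (Hborel : borel_for r).
Variables (Q : set T) (mQ : measurable Q).
Variables (mu : {measure set T -> \bar R}) (Hmu : (mu setT < +oo)%E).
Variables (w : R -> R) (Hw : modulus_of_continuity w).

Let chi (f : T -> X) t := if pselect (Q t) then f t else ltheta X.

Lemma modulus_partition e : 0 < e ->
  exists m (A : 'I_m -> set T) (p : 'I_m -> T),
    mpartition A /\ forall i t, A i t -> w (r (p i) t) <= e.
Proof.
move=> /(modulus_small Hw)[dl dl0 wdl].
have [m [A [p [pA Ap]]]] := rcompact_partition Hr Hborel HT dl0.
exists m, A, p; split=> // i t /Ap; apply: wdl; exact: metric_ge0.
Qed.

Lemma modulus_measurable (g : T -> R) :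
  (forall s t, `|g s - g t| <= w (r s t)) -> measurable_fun setT g.
Proof.
move=> gw; apply: (rcontinuous_measurable Hborel) => t e /(modulus_small Hw).
move=> [dl dl0 wdl]; exists dl => // s ts; apply: le_trans (gw _ _) _.
by apply: wdl => //; exact: metric_ge0.
Qed.

(** On [Q] the distance to [y] has modulus [w] by the triangle inequality; off [Q] it is
    constant. *)
Lemma Hclass_Xmeasurable f : Hclass r w f -> Xmeasurable (chi f).
Proof.
move=> Wf y.
have -> : (fun t => ldist X (chi f t) y) =
    (fun t => ldist X (f t) y * \1_Q t + ldist X (ltheta X) y * \1_(~` Q) t).
  apply/funext => t; rewrite /chi !indicE in_setC; case: pselect => Qt.
    by rewrite mem_set //= mulr1 mulr0 addr0.
  by rewrite memNset //= mulr1 mulr0 add0r.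
apply: measurable_funD; apply: measurable_funM => //.
- apply: modulus_measurable => s t; rewrite ler_norml.
  have := Wf s t; have := ldist_triangle (f s) (f t) y.
  have := ldist_triangle (f t) (f s) y; rewrite [ldist X (f t) (f s)]ldistC.
  lra.
- by apply: measurable_indic; exact: measurableC.
Qed.

Lemma Hclass_step f e m (A : 'I_m -> set T) (p : 'I_m -> T) : Hclass r w f ->
  mpartition A -> (forall i t, A i t -> w (r (p i) t) <= e) -> 0 <= e ->
  exists g, simple_integral mu P g
    (\big[ladd X/ltheta X]_(i < m) lsmul X (fine (mu (A i `&` Q))) (P (f (p i))))
    /\ forall t, ldist X (g t) (chi f t) <= e.
Proof.
move=> Wf pA Ap e0.
have /choice[idx idxA] t : exists i, A i t by exact: mpartition_ex.
exists (chi (fun t => f (p (idx t)))); split.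
  apply: (simple_integral_on (v := fun i => f (p i)) _ HP mQ pA).
  - move=> i t At Qt; rewrite /chi; case: pselect => // Qt'.
    by rewrite (mpartition_inj pA (idxA t) At).
  - by move=> t nQt; rewrite /chi; case: pselect.
move=> t; rewrite /chi; case: pselect => Qt; last by rewrite ldistxx.
exact: le_trans (Wf _ _) (Ap _ _ (idxA t)).
Qed.

Lemma Hclass_unif_simple f : Hclass r w f -> unif_simple mu P (chi f).
Proof.
move=> Wf e e0; have [m [A [p [pA Ap]]]] := modulus_partition e0.
have [g [gu gf]] := Hclass_step Wf pA Ap (ltW e0).
by exists g; eexists; split; first exact: gu.
Qed.

(** * The minimum function of the nodes and the upper bound *)

Variables (n : nat) (hn : (0 < n)%N) (x : 'I_n -> T).

(** The extended-real integrand of the error formula; [minw] is its real value, finite because there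
    is at least one node. *)
Let mine t := (\big[Order.min / +oo]_(i < n) (w (r (x i) t))%:E)%E.
Let minw t := fine (mine t).

Lemma minw_ex t : exists2 i, minw t = w (r (x i) t) & mine t = (minw t)%:E.
Proof.
have [|i _ E] := @eq_bigmin _ _ _ (+oo%E : \bar R) (Ordinal hn) xpredT
  (fun i => (w (r (x i) t))%:E) isT.
  by move=> i _; rewrite leey.
by exists i; rewrite /minw /mine E.
Qed.

Lemma mineE t : mine t = (minw t)%:E.
Proof. by have [] := minw_ex t. Qed.

Lemma minw_le i t : minw t <= w (r (x i) t).
Proof. by rewrite -lee_fin -mineE; exact: bigmin_le. Qed.

Lemma minw_ge0 t : 0 <= minw t.
Proof.
have [i -> _] := minw_ex t; case: Hw => _ _ w0 _ _; apply: w0.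
exact: metric_ge0.
Qed.

Lemma minw_node i : minw (x i) = 0.
Proof.
apply/le_anti; rewrite minw_ge0 andbT.
by apply: le_trans (minw_le i _) _; rewrite (metricxx Hr); case: Hw => _ _ _ ->.
Qed.

(** The node that is best for one point also serves the other, at an extra cost bounded through
    monotonicity and subadditivity of [w]. *)
Lemma minw_modulus s t : `|minw s - minw t| <= w (r s t).
Proof.
suff H u v : minw u <= minw v + w (r u v).
  have := H s t; have := H t s; rewrite (metricC Hr t s) ler_norml; lra.
have [i -> _] := minw_ex v; apply: le_trans (minw_le i _) _.
case: Hw => incr _ _ _ sub.
apply: le_trans (sub _ _ _ _); rewrite ?(metric_ge0 Hr) //.
apply: incr; first exact: metric_ge0.
by rewrite (metricC Hr u v); exact: metric_triangle.
Qed.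

Lemma minw_partT i t : partT r x i t -> minw t = w (r (x i) t).
Proof.
move=> [Tit _]; apply/le_anti; rewrite minw_le /=.
have [j -> _] := minw_ex t; have [->//|ji] := eqVneq j i.
case: Hw => incr _ _ _ _; apply: incr; first exact: metric_ge0.
by rewrite ![r (x _) t](metricC Hr); exact: Tit.
Qed.

Lemma recovery_upper f : Hclass r w f ->
  ((ldist X (Xintegral_on mu P Q f)
    (\big[ladd X / ltheta X]_(i < n)
       lsmul X (fine (mu (partT r x i `&` Q))) (P (f (x i)))))%:E
   <= \int[mu]_(t in Q) mine t)%E.
Proof.
move=> Wf; have pV := partT_mpartition Hr Hborel hn x.
have /choice[idx idxV] t : exists i, partT r x i t by exact: mpartition_ex.
pose g := chi (fun t => f (x (idx t))).
have gE : simple_integral mu P g (\big[ladd X / ltheta X]_(i < n)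
       lsmul X (fine (mu (partT r x i `&` Q))) (P (f (x i)))).
  apply: (simple_integral_on (v := fun i => f (x i)) _ HP mQ pV).
  - move=> i t Vt Qt; rewrite /g /chi; case: pselect => // Qt'.
    by rewrite (mpartition_inj pV (idxV t) Vt).
  - by move=> t nQt; rewrite /g /chi; case: pselect.
rewrite integral_mkcond.
have -> : ((fun t => mine t) \_ Q)%E = fun t => (minw t * \1_Q t)%:E.
  apply/funext => t; rewrite patchE indicE mineE.
  by case: ifP => _; rewrite ?mulr1 ?mulr0.
apply: (Xintegral_dist_integral Hmu HP _ _ gE) => //.
- exact: Hclass_Xmeasurable.
- exact: Hclass_unif_simple.
- apply: measurable_funM; first exact: modulus_measurable minw_modulus.
  exact: measurable_indic.
- move=> t; rewrite /g /chi indicE; case: pselect => Qt.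
    (* In its Voronoi cell the nearest node attains the minimum, so the bound is the class condition
       itself. *)
    rewrite mem_set // mulr1 ldistC (minw_partT (idxV t)); exact: Wf.
  by rewrite ldistxx memNset // mulr0.
Qed.

(** * Extremal functions and the lower bound *)

Lemma minw_lsmul_Hclass z : is_convex z -> ldist X z (ltheta X) = 1 ->
  Hclass r w (fun t => lsmul X (minw t) z).
Proof.
move=> cz z1 s t; apply: le_trans (ldist_lsmul_convex cz _ _) _.
- exact: minw_ge0.
- exact: minw_ge0.
- by rewrite z1 mulr1 minw_modulus.
Qed.

(** [P] fixes nonnegative multiples of [z], so the step function integrates to a real Riemann sum
    times [z]. The same sum appears in [integral_minw_le], which links the two integrals. *)
Lemma Xintegral_minw_lsmul e m (A : 'I_m -> set T) (p : 'I_m -> T) z :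
  is_convex z -> ldist X z (ltheta X) = 1 -> mpartition A ->
  (forall i t, A i t -> w (r (p i) t) <= e) -> 0 <= e ->
  ldist X (Xintegral_on mu P Q (fun t => lsmul X (minw t) z))
    (lsmul X (\sum_i minw (p i) * fine (mu (A i `&` Q))) z) <= e * fine (mu setT).
Proof.
move=> cz z1 pA Ap e0; have Wz := minw_lsmul_Hclass cz z1.
have [g [gu gf]] := Hclass_step Wz pA Ap e0.
rewrite convex_sum //; last by move=> i; rewrite mulr_ge0 ?minw_ge0.
under eq_bigr => i _.
  rewrite mulrC -lsmulA -(convexifying_id HP (is_convex_lsmul (minw_ge0 (p i)) cz)).
  over.
apply: (Xintegral_dist_le Hmu HP _ _ gu gf).
- exact: Hclass_Xmeasurable.
- exact: Hclass_unif_simple.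
Qed.

Lemma integral_minw_le e m (A : 'I_m -> set T) (p : 'I_m -> T) :
  mpartition A -> (forall i t, A i t -> w (r (p i) t) <= e) -> 0 <= e ->
  (\int[mu]_(t in Q) mine t <=
   (\sum_i minw (p i) * fine (mu (A i `&` Q)) + e * fine (mu setT))%:E)%E.
Proof.
move=> pA Ap e0; have [mA _ _] := pA.
rewrite EFinD -integral_sum_indic //; last by move=> i; exact: minw_ge0.
apply: (@le_trans _ _ (\int[mu]_(t in Q) (\sum_i minw (p i) * \1_(A i) t)%:E
   + \int[mu]_(t in Q) cst e%:E t)%E); last first.
  apply: leeD2l; rewrite integral_cst // EFinM fineK ?(measure_fin_num Hmu) //.
  by apply: lee_wpmul2l; rewrite ?lee_fin // le_measure ?inE.
have mS : measurable_fun Q (fun t => \sum_i minw (p i) * \1_(A i) t).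
  by apply: measurable_funS (measurable_sum_indic _ mA).
rewrite -ge0_integralD //.
- apply: ge0_le_integral => //.
  + by move=> t _; rewrite mineE lee_fin minw_ge0.
  + apply: eq_measurable_fun (_ : measurable_fun Q (fun t => (minw t)%:E)).
      by move=> t _; rewrite mineE.
    apply/measurable_EFinP; apply: measurable_funS (modulus_measurable minw_modulus) => //.
  + by apply: emeasurable_funD => //; exact/measurable_EFinP.
  + move=> t _; rewrite mineE /= -EFinD lee_fin.
    have [i At] := mpartition_ex t pA; rewrite (mpartition_indic _ pA At).
    have := Ap _ _ At; have := minw_modulus (p i) t; rewrite ler_norml; lra.
- by move=> t _; rewrite lee_fin sumr_ge0 // => i _; rewrite mulr_ge0 ?minw_ge0.
- exact/measurable_EFinP.
Qed.

Lemma recovery_lower z z' : is_convex z -> ldist X z (ltheta X) = 1 ->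
  ladd X z z' = ltheta X ->
  exists2 c, (\int[mu]_(t in Q) mine t)%E = c%:E &
    2 * c <= ldist X (Xintegral_on mu P Q (fun t => lsmul X (minw t) z))
                     (Xintegral_on mu P Q (fun t => lsmul X (minw t) z')).
Proof.
move=> cz z1 zz'; have cz' := inverse_convex zz' cz.
have z1' : ldist X z' (ltheta X) = 1 by rewrite (ldist_inverse_theta zz').
set c0 := (\int[mu]_(t in Q) mine t)%E.
have c0_fin : c0 \is a fin_num.
  rewrite ge0_fin_numE; last first.
    by apply: integral_ge0 => t _; rewrite mineE lee_fin minw_ge0.
  have [m [A [p [pA Ap]]]] := modulus_partition ltr01.
  by apply: le_lt_trans (integral_minw_le pA Ap ler01) _; rewrite ltry.
exists (fine c0); first by rewrite fineK.
set M := fine (mu setT).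
have M0 : 0 <= M by exact: fine_ge0.
have M1 : 0 < M + 1 by rewrite ltr_wpDl.
apply/ler_addgt0Pr => /= eta eta0.
(* With [s] the common Riemann sum, passing from [c] to [s] costs [e M] twice, and replacing [s z]
   and [s z'] by the integrals costs [e M] each: four errors in all. *)
pose e := eta / (4 * (M + 1)).
have e0 : 0 < e by rewrite divr_gt0 // mulr_gt0.
have eM : e * M <= eta / 4 by apply: div_succ_mul_le => //; exact: ltW.
have [m [A [p [pA Ap]]]] := modulus_partition e0.
have := integral_minw_le pA Ap (ltW e0).
rewrite -/c0 -(fineK c0_fin) lee_fin -/M.
have := Xintegral_minw_lsmul cz z1 pA Ap (ltW e0).
have := Xintegral_minw_lsmul cz' z1' pA Ap (ltW e0).
rewrite -/M; set s := \sum_i _; set I' := Xintegral_on _ _ _ _; set I := Xintegral_on _ _ _ _.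
have s0 : 0 <= s by apply: sumr_ge0 => i _; rewrite mulr_ge0 ?minw_ge0.
have := ldist_lsmul_inverse zz' s0 cz; rewrite z1 mulr1.
have := ldist_triangle (lsmul X s z) I (lsmul X s z').
have := ldist_triangle I I' (lsmul X s z').
rewrite [ldist X (lsmul X s z) I]ldistC; lra.
Qed.

End OptimalRecovery.

(** * Both bounds combined: the optimal error and the optimality of [Phistar] *)

Theorem theorem4 (R : realType) (X : LSpace R) (P : X -> X)
  (HP : convexifying P)
  (Hnontriv : exists z : X, [/\ is_invertible z, is_convex z & z <> ltheta X])
  (d : measure_display) (T : measurableType d) (r : T -> T -> R)
  (Hr : is_metric r) (HT : rcompact r setT) (Hborel : borel_for r)
  (Q : set T) (HQ : rcompact r Q)
  (mu : {measure set T -> \bar R}) (Hmu : (mu setT < +oo)%E)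
  (w : R -> R) (Hw : modulus_of_continuity w)
  (n : nat) (hn : (0 < n)%N) (x : 'I_n -> T) :
  let Lam := fun f : T -> X => Xintegral_on mu P Q f in
  let Inf := fun (f : T -> X) (i : 'I_n) => P (f (x i)) in
  let Phistar := fun y : 'I_n -> X =>
      \big[ladd X / ltheta X]_(i < n) lsmul X (fine (mu (partT r x i `&` Q))) (y i) in
  optimal_error (ldist X) Lam (Hclass (X:=X) r w) Inf
    = (\int[mu]_(t in Q) (\big[Order.min / +oo%E]_(i < n) (w (r (x i) t))%:E))%E
  /\ method_error (ldist X) Lam (Hclass (X:=X) r w) Inf Phistar
    = optimal_error (ldist X) Lam (Hclass (X:=X) r w) Inf.
Proof.
move=> Lam Inf Phistar; set C := (\int[mu]_(t in Q) _)%E.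
have mQ := rcompact_measurable Hr Hborel HQ.
have upper : (method_error (ldist X) Lam (Hclass (X:=X) r w) Inf Phistar <= C)%E.
  apply: ge_ereal_sup => _ [f Wf <-].
  exact: (recovery_upper HP Hr HT Hborel mQ Hmu Hw hn).
have lower Phi : (C <= method_error (ldist X) Lam (Hclass (X:=X) r w) Inf Phi)%E.
  have [z0 [[z0' zz0] cz0 z0N]] := Hnontriv.
  (* Scaling to norm 1 preserves convexity and invertibility. *)
  pose a := (ldist X z0 (ltheta X))^-1.
  have a0 : 0 < ldist X z0 (ltheta X).
    by rewrite lt_neqAle ldist_ge0 andbT eq_sym; apply/eqP => /ldist_eq0.
  pose z := lsmul X a z0; pose z' := lsmul X a z0'.
  have cz : is_convex z by apply: is_convex_lsmul => //; rewrite invr_ge0 ltW.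
  have z1 : ldist X z (ltheta X) = 1.
    by rewrite ldist_lsmul_theta ger0_norm ?invr_ge0 ?ltW // mulVf ?gt_eqF.
  have zz' : ladd X z z' = ltheta X by exact: lsmul_inverse.
  have [c Cc dc] := recovery_lower HP Hr HT Hborel mQ Hmu Hw hn x cz z1 zz'.
  have err y : is_convex y -> ldist X y (ltheta X) = 1 ->
      ((ldist X (Lam (fun t => lsmul X
         (fine (\big[Order.min / +oo%E]_(i < n) (w (r (x i) t))%:E)) y))
         (Phi (fun=> ltheta X)))%:E
        <= method_error (ldist X) Lam (Hclass (X:=X) r w) Inf Phi)%E.
    move=> cy y1; apply: ereal_sup_ubound.
    exists (fun t => lsmul X
         (fine (\big[Order.min / +oo%E]_(i < n) (w (r (x i) t))%:E)) y).
      exact: minw_lsmul_Hclass.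
    (* The minimum function vanishes at every node, so the information is theta whatever [y] is. *)
    congr (ldist _ _ (Phi _))%:E; apply/funext => i; rewrite /Inf.
    by rewrite (minw_node Hr Hw hn) lsmul0 (convexifying_theta HP).
  have errz := err _ cz z1.
  have errz' : _ := err z' (inverse_convex zz' cz) _.
  rewrite (ldist_inverse_theta zz') in errz'; have {}errz' := errz' z1.
  rewrite [C]Cc; move: dc errz errz'.
  set I := Xintegral_on _ _ _ _; set I' := Xintegral_on _ _ _ _.
  rewrite -/(Lam _) -/I -/I' => dc errz errz'.
  set y := Phi _ in errz errz'.
  (* The integrals are at least [2c] apart, so the single answer [y] is at distance at least [c]
     from one of them. *)
  have [cy|cy] := leP c (ldist X I y); first by apply: le_trans errz; rewrite lee_fin.
  apply: le_trans errz'; rewrite lee_fin.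
  have := ldist_triangle I y I'; rewrite [ldist X y I']ldistC; lra.
have opt : optimal_error (ldist X) Lam (Hclass (X:=X) r w) Inf = C.
  apply/le_anti/andP; split.
    by apply: le_trans upper; apply: ereal_inf_lbound; exists Phistar.
  by apply: le_ereal_inf_tmp => _ [Phi _ <-].
by split=> //; rewrite opt; apply/le_anti; rewrite upper lower.
Qed.
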